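(* For all integers $m,n\ge 1$, $\chi_{lt}(mC_6+nP_6)=2n+1$.
   Context: $G+H$ is the disjoint union of $G$ and $H$, $mG$ is the disjoint union of $m$ copies of $G$, $P_n$ is the path on $n$ vertices and $C_n$ is the cycle on $n$ vertices. For a finite simple graph $G=(V,E)$ of order $p$ and size $q$, a local total antimagic labeling is a bijection $f:V\cup E\to\{1,\dots,p+q\}$ such that, with weights $w_f(u)=\sum f(e)$ over all edges $e$ incident to $u$ for $u\in V$ (the label of $u$ itself is not included) and $w_f(uv)=f(u)+f(v)$ for $uv\in E$, one has: adjacent vertices have distinct weights, adjacent edges have distinct weights, and every vertex has a weight distinct from that of each of its incident edges. $\chi_{lt}(G)$ is the minimum, over all local total antimagic labelings $f$ of $G$, of the number of distinct values among all the vertex and edge weights. *)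

(* Defs.v *)
From mathcomp Require Import all_boot.

Set Implicit Arguments.
Unset Strict Implicit.
Unset Printing Implicit Defensive.

Record sgraph := SGraph {
  vertex :> finType;
  adj : rel vertex;
  adj_sym : symmetric adj;
  adj_irr : irreflexive adj }.

Section Constructions.

Definition sum_adj (G H : sgraph) : rel (G + H)%type := fun x y =>
  match x, y with
  | inl u, inl v => adj u v
  | inr u, inr v => adj u v
  | _, _ => false
  end.

Lemma sum_adj_sym G H : symmetric (@sum_adj G H).
Proof. by case=> u [] v //=; apply: adj_sym. Qed.

Lemma sum_adj_irr G H : irreflexive (@sum_adj G H).
Proof. by case=> u /=; apply: adj_irr. Qed.

Definition disjoint_union (G H : sgraph) : sgraph :=
  SGraph (@sum_adj_sym G H) (@sum_adj_irr G H).

Definition copies_adj m (G : sgraph) : rel ('I_m * G)%type :=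
  fun x y => (x.1 == y.1) && adj x.2 y.2.

Lemma copies_adj_sym m G : symmetric (@copies_adj m G).
Proof. by move=> x y; rewrite /copies_adj eq_sym adj_sym. Qed.

Lemma copies_adj_irr m G : irreflexive (@copies_adj m G).
Proof. by move=> x; rewrite /copies_adj adj_irr andbF. Qed.

Definition copies m (G : sgraph) : sgraph :=
  SGraph (@copies_adj_sym m G) (@copies_adj_irr m G).

Definition path_adj n : rel 'I_n := fun i j => (i.+1 == j) || (j.+1 == i).

Lemma path_adj_sym n : symmetric (@path_adj n).
Proof. by move=> i j; rewrite /path_adj orbC. Qed.

Lemma path_adj_irr n : irreflexive (@path_adj n).
Proof. by move=> i; rewrite /path_adj orbb eqn_leq ltnn. Qed.

Definition path_graph n : sgraph := SGraph (@path_adj_sym n) (@path_adj_irr n).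

(* The condition i != j only matters for the degenerate case n = 1. *)
Definition cycle_adj n : rel 'I_n := fun i j =>
  (i != j) && ((i.+1 %% n == j) || (j.+1 %% n == i)).

Lemma cycle_adj_sym n : symmetric (@cycle_adj n).
Proof. by move=> i j; rewrite /cycle_adj eq_sym orbC. Qed.

Lemma cycle_adj_irr n : irreflexive (@cycle_adj n).
Proof. by move=> i; rewrite /cycle_adj eqxx. Qed.

Definition cycle_graph n : sgraph :=
  SGraph (@cycle_adj_sym n) (@cycle_adj_irr n).

End Constructions.

Section LocalTotalAntimagic.

Variable G : sgraph.

Definition edge_set : {set {set G}} :=
  [set A : {set G} | [exists u : G, exists v : G,
     adj u v && (A == [set u; v])]].

Definition edge : finType := {A : {set G} | A \in edge_set}.

Definition element : finType := (G + edge)%type.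

Definition total_labeling (f : element -> nat) : Prop :=
  injective f /\
  forall k : nat, 1 <= k <= #|G| + #|edge_set| <-> exists x, f x = k.

(* On an edge {u, v} the sum is f u + f v, since u != v. *)
Definition weight (f : element -> nat) (x : element) : nat :=
  match x with
  | inl u => \sum_(e : edge | u \in val e) f (inr e)
  | inr e => \sum_(u in val e) f (inl u)
  end.

Definition local_total_antimagic (f : element -> nat) : Prop :=
  [/\ total_labeling f,
      forall u v : G, adj u v -> weight f (inl u) <> weight f (inl v),
      forall e1 e2 : edge, e1 <> e2 -> val e1 :&: val e2 <> set0 ->
        weight f (inr e1) <> weight f (inr e2)
    & forall (u : G) (e : edge), u \in val e ->
        weight f (inl u) <> weight f (inr e)].

Definition num_weights (f : element -> nat) : nat :=
  size (undup [seq weight f x | x <- enum element]).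

(* chi_lt G = k, as a relation: the minimum does not exist for graphs having
   no local total antimagic labeling, such as K_2. *)
Definition chi_lt_eq (k : nat) : Prop :=
  (exists2 f, local_total_antimagic f & num_weights f = k) /\
  (forall f, local_total_antimagic f -> k <= num_weights f).

End LocalTotalAntimagic.

(* Main.v *)
Require Import Defs.
From mathcomp Require Import all_boot.
From mathcomp Require Import zify.

(** Write N for the number of elements. A vertex or edge labelled N forces a
    weight above N, while the 2n leaves have pairwise distinct weights, namely
    the labels of their pendant edges, all at most N: hence 2n+1 weights.

    Conversely, put c = N+1 and realise all weights in [c-2n, c]. The edges of
    the i-th path (1 <= i <= n) get c-i, i, c-2n-i, n+i, c-n-i, which uses up
    1..2n and c-3n..N. The remaining interval is cut into 2m+n blocks
    {y, y+1, y+2, c-n-y, c-n-y-1, c-n-y-2}, one for the vertices of each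
    component and one for the edges of each cycle. In a block, a low and a high
    element add up to c-n-1, c-n or c-n+1 when their offsets differ by at most
    one, and six of these seven pairs form a 6-cycle along which the three sums
    repeat periodically. *)

Set Implicit Arguments.
Unset Strict Implicit.
Unset Printing Implicit Defensive.

Lemma uniq_map_inj_in (T U : eqType) (f : T -> U) (r : seq T) :
  uniq (map f r) -> {in r &, injective f}.
Proof.
elim: r => //= a r IHr /andP[fa /IHr inj] x y.
rewrite !inE => /predU1P[->|xr] /predU1P[->|yr] // fxy; last exact: inj.
  by rewrite fxy map_f in fa.
by rewrite -fxy map_f in fa.
Qed.

(** * Graphs whose edges carry explicit indices *)

Section EdgeIndexing.

Variable G : sgraph.

(** Edges of [G] are two-element sets in a subtype. Naming them by a plain finite type turns each
    vertex weight into a sum over the explicit list [inc u]. *)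
Record edge_indexing (I : finType) (s t : I -> G) (inc : G -> seq I) : Prop :=
  EdgeIndexing {
    ends_adj : forall i, adj (s i) (t i);
    adj_ends : forall u v, adj u v -> exists i, [set u; v] = [set s i; t i];
    ends_inj : injective (fun i => [set s i; t i]);
    inc_uniq : forall u, uniq (inc u);
    mem_inc : forall u i, (i \in inc u) = (u == s i) || (u == t i) }.

Variables (I : finType) (s t : I -> G) (inc : G -> seq I).

Lemma edge_indexing_bij :
  edge_indexing s t inc ->
  exists E : I -> edge G,
    bijective E /\ forall i, val (E i) = [set s i; t i].
Proof.
move=> ix.
have mem i : [set s i; t i] \in edge_set G.
  rewrite inE; apply/existsP; exists (s i); apply/existsP; exists (t i).
  by rewrite (ends_adj ix) eqxx.
pose E i : edge G := Sub [set s i; t i] (mem i).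
have sur (e : edge G) : exists i, E i = e.
  have := valP e; rewrite inE => /existsP[u] /existsP[v] /andP[uv /eqP eE].
  have [i st] := adj_ends ix uv.
  by exists i; apply: val_inj; rewrite /= -st eE.
have [E' EE'] := fin_all_exists sur.
exists E; split=> //; exists E' => // i; apply: (ends_inj ix).
exact: (congr1 val (EE' (E i))).
Qed.

(** There are exactly as many elements as admissible labels, so injectivity within the range forces
    surjectivity. *)
Lemma total_labeling_bounded (f : element G -> nat) :
    injective f -> (forall x, 0 < f x <= #|G| + #|edge_set G|) ->
  total_labeling f.
Proof.
move=> f_inj f_le; split=> // k.
have card_el : size (enum (element G)) = #|G| + #|edge_set G|.
  by rewrite -cardE card_sum card_sig.
pose r := [seq f x | x <- enum (element G)].
have r_uniq : uniq r by rewrite map_inj_uniq ?enum_uniq.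
have r_sub : {subset r <= iota 1 (#|G| + #|edge_set G|)}.
  by move=> _ /mapP[x _ ->]; rewrite mem_iota add1n ltnS.
have [|_ rE] := uniq_min_size r_uniq r_sub.
  by rewrite size_iota size_map card_el.
have -> : (1 <= k <= #|G| + #|edge_set G|) = (k \in r).
  by rewrite rE mem_iota add1n ltnS.
by split=> [/mapP[x _ ->]|[x <-]]; [exists x | rewrite map_f ?mem_enum].
Qed.

(** Reduces the upper bound to arithmetic on indices. Adjacent edges share a vertex [u], so
    [uniq (map we (inc u))] separates their weights. *)
Lemma indexed_labeling (vlab : G -> nat) (elab : I -> nat)
    (wv : G -> nat) (we : I -> nat) (N : nat) (W : seq nat) :
    edge_indexing s t inc ->
    injective vlab -> injective elab ->
    (forall u i, vlab u <> elab i) ->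
    #|G| + #|I| = N ->
    (forall u, 0 < vlab u <= N) -> (forall i, 0 < elab i <= N) ->
    (forall u, \sum_(i <- inc u) elab i = wv u) ->
    (forall i, vlab (s i) + vlab (t i) = we i) ->
    (forall i, wv (s i) != wv (t i)) ->
    (forall i, (wv (s i) != we i) && (wv (t i) != we i)) ->
    (forall u, uniq (map we (inc u))) ->
    (forall u, wv u \in W) -> (forall i, we i \in W) ->
  exists2 f, @local_total_antimagic G f & num_weights f <= size W.
Proof.
move=> ix vinj einj ve_neq cardN vN eN wvE weE vv ve ee wvW weW.
have [E [[E' EK EK'] valE]] := edge_indexing_bij ix.
have cardI : #|I| = #|edge_set G|.
  by rewrite (bij_eq_card (Bijective EK EK')) card_sig.
pose f (x : element G) :=
  match x with inl u => vlab u | inr e => elab (E' e) end.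
have wfv u : weight f (inl u) = wv u.
  rewrite -wvE /= (reindex E) /=; last by exists E' => x _.
  rewrite big_uniq ?(inc_uniq ix) //; apply: eq_big => [i|i _];
    last by rewrite EK.
  by rewrite valE (mem_inc ix) !inE.
have wfe e : weight f (inr e) = we (E' e).
  rewrite -weE /= -{1}(EK' e) valE big_setU1 ?big_set1 // inE.
  by apply: contraTneq (ends_adj ix (E' e)) => ->; rewrite adj_irr.
exists f; first split.
- apply: total_labeling_bounded => [[u|e] [v|e'] /=|[u|e] /=].
  + by move/vinj->.
  + by move/ve_neq.
  + by move/esym/ve_neq.
  + by move/einj/(can_inj EK')->.
  + by rewrite -cardI cardN.
  + by rewrite -cardI cardN.
- move=> u v uv; rewrite !wfv.
  have [i st] := adj_ends ix uv.
  have uv_neq : u != v by apply: contraTneq uv => ->; rewrite adj_irr.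
  have: u \in [set s i; t i] by rewrite -st !inE eqxx.
  have: v \in [set s i; t i] by rewrite -st !inE eqxx orbT.
  move: uv_neq; rewrite !inE => /[swap] /pred2P[]-> /[swap] /pred2P[]->;
    rewrite ?eqxx // => _.
  + by move/eqP; rewrite eq_sym (negPf (vv i)).
  + by move/eqP; rewrite (negPf (vv i)).
- move=> e1 e2 e12 /eqP/set0Pn[u]; rewrite inE !wfe.
  rewrite -{1}(EK' e1) -{1}(EK' e2) !valE !inE -!(mem_inc ix) => /andP[u1 u2] w.
  apply: e12; apply: (can_inj EK').
  exact: uniq_map_inj_in (ee u) _ _ u1 u2 w.
- move=> u e; rewrite -{1}(EK' e) valE !inE wfv wfe => /pred2P[]->; apply/eqP;
  by case/andP: (ve (E' e)).
rewrite /num_weights; apply: uniq_leq_size; first exact: undup_uniq.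
move=> w; rewrite mem_undup => /mapP[[u|e] _ ->].
  by rewrite wfv.
by rewrite wfe.
Qed.

(** The element labelled [N] pushes a weight above [N]: a vertex does so through any incident edge,
    hence no isolated vertices; an edge does so at an endpoint of degree at least two, hence no
    isolated edges. *)
Lemma leaf_lower_bound (L : finType) (leaf : L -> G) (pend : L -> I)
    (f : element G -> nat) :
    edge_indexing s t inc -> injective pend ->
    (forall l, inc (leaf l) = [:: pend l]) ->
    (forall u, inc u != [::]) ->
    (forall i, (1 < size (inc (s i))) || (1 < size (inc (t i)))) ->
    0 < #|G| -> total_labeling f ->
  #|L|.+1 <= num_weights f.
Proof.
move=> ix pinj leafE inc0 inc2 G_gt0 [f_inj f_onto].
have [E [[E' EK EK'] valE]] := edge_indexing_bij ix.
set N := #|G| + #|edge_set G| in f_onto.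
have f_le x : 0 < f x <= N by apply/f_onto; exists x.
have memE u i : (u \in val (E i)) = (i \in inc u).
  by rewrite valE (mem_inc ix) !inE.
have w_leaf l : weight f (inl (leaf l)) = f (inr (E (pend l))).
  rewrite /= (big_pred1 (E (pend l))) // => e.
  by rewrite -(EK' e) memE leafE inE /= (can_eq EK).
have [x w_gt] : exists x, N < weight f x.
  have [x fx] : exists x, f x = N.
    by apply/f_onto; rewrite leqnn andbT /N addn_gt0 G_gt0.
  case: x fx => [u|e] fN.
    case incE: (inc u) (inc0 u) => [//|i r] _.
    have: i \in inc u by rewrite incE mem_head.
    rewrite -memE => ui; exists (inr (E i)).
    have st : s i != t i.
      by apply: contraTneq (ends_adj ix i) => ->; rewrite adj_irr.
    move: ui; rewrite /= valE big_setU1 ?inE // big_set1 => ui.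
    have /andP[s0 _] := f_le (inl (s i)).
    have /andP[t0 _] := f_le (inl (t i)).
    by case/pred2P: ui s0 t0 => <-; rewrite fN /=; lia.
  have [u ue uinc] : exists2 u, E' e \in inc u & 1 < size (inc u).
    by case/orP: (inc2 (E' e)) => ?;
       [exists (s (E' e)) | exists (t (E' e))];
       rewrite ?(mem_inc ix) ?eqxx ?orbT.
  (* [inc u] is duplicate-free with at least two entries, so it contains an index other than that of
     [e]. *)
  have [i iu ie] : exists2 i, i \in inc u & i != E' e.
    apply/hasP; apply: contraTT uinc => /hasPn all_e; rewrite -leqNgt.
    apply: (@uniq_leq_size _ _ [:: E' e]); first exact: inc_uniq ix u.
    by move=> i /all_e; rewrite negbK inE.
  exists (inl u); rewrite /= (bigD1 e) /=; last by rewrite -(EK' e) memE.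
  rewrite (bigD1 (E i)) /=; last first.
    by rewrite memE iu; apply: contraNneq ie => <-; rewrite EK.
  by have := f_le (inr (E i)); rewrite fN /=; lia.
pose r := weight f x :: [seq f (inr (E (pend l))) | l <- enum L].
have sz_r : size r = #|L|.+1 by rewrite /= size_map cardE.
rewrite -sz_r; apply: uniq_leq_size.
  rewrite /= map_inj_uniq ?enum_uniq ?andbT.
    apply/mapP=> [[l _ w]]; have := f_le (inr (E (pend l))).
    by rewrite -w; lia.
  by move=> l l' /f_inj[] /(can_inj EK) /pinj.
move=> w; rewrite mem_undup inE => /predU1P[->|/mapP[l _ ->]].
  by rewrite map_f ?mem_enum.
by rewrite -w_leaf map_f ?mem_enum.
Qed.

End EdgeIndexing.

Lemma ordS_ord_pred6 (v e : 'I_6) :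
  (e \in [:: v; ord_pred v]) = (v == e) || (v == ordS e).
Proof.
by move: v e; do 2![case=> [[|[|[|[|[|[|//]]]]]] ?]].
Qed.

(* The positions in a block of the labels around a cycle (or path); the edge
   positions traverse the same 6-cycle of sums starting two steps later, so that
   each vertex weight differs from the four weights next to it. *)
Definition vertex_slot (v : 'I_6) : nat := nth 0 [:: 4; 0; 3; 1; 5; 2] v.
Definition edge_slot (e : 'I_6) : nat := nth 0 [:: 3; 1; 5; 2; 4; 0] e.

Lemma vertex_slot_lt v : vertex_slot v < 6.
Proof. by case: v => [[|[|[|[|[|[|//]]]]]] ?]. Qed.

Lemma edge_slot_lt e : edge_slot e < 6.
Proof. by case: e => [[|[|[|[|[|[|//]]]]]] ?]. Qed.

Lemma vertex_slot_inj : injective vertex_slot.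
Proof. by move=> v v' /eqP; rewrite nth_uniq // => /eqP/val_inj. Qed.

Lemma edge_slot_inj : injective edge_slot.
Proof. by move=> e e' /eqP; rewrite nth_uniq // => /eqP/val_inj. Qed.

(** * Explicit labels for the 6-cycles and the paths *)

Section CyclesAndPaths.

Variables m n : nat.
Hypothesis n_gt0 : 0 < n.

Let G : sgraph :=
  disjoint_union (copies m (cycle_graph 6)) (copies n (path_graph 6)).
Let V : finType := ('I_m * 'I_6 + 'I_n * 'I_6)%type.
Let I : finType := ('I_m * 'I_6 + 'I_n * 'I_5)%type.

(** Edge [e] leads from vertex [e] to the next one, cyclically on a cycle; thus a cycle has six edge
    indices and a path five. *)
Definition source (i : I) : V :=
  match i with
  | inl (j, e) => inl (j, e)
  | inr (j, e) => inr (j, widen_ord (leqnSn 5) e)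
  end.

Definition target (i : I) : V :=
  match i with
  | inl (j, e) => inl (j, ordS e)
  | inr (j, e) => inr (j, lift ord0 e)
  end.

Definition incident (u : V) : seq I :=
  match u with
  | inl (j, v) => [:: inl (j, v); inl (j, ord_pred v)]
  | inr (j, v) =>
    match val v with
    | 0 => [:: inr (j, inord 0)]
    | 5 => [:: inr (j, inord 4)]
    | k => [:: inr (j, inord k.-1); inr (j, inord k)]
    end
  end.

Lemma mem_incident u i :
  (i \in incident u) = (u == source i) || (u == target i).
Proof.
case: u i => [[j v]|[j v]] [[j' e]|[j' e]].
- have := ordS_ord_pred6 v e; rewrite !inE /= !(inj_eq inl_inj) !xpair_eqE.
  by rewrite (eq_sym j j') -!andb_orr => ->.
- by [].
- by case: v => [[|[|[|[|[|[|]]]]]] ?].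
- rewrite /source /target !(inj_eq inr_inj) !xpair_eqE.
  case: v => [[|[|[|[|[|[|//]]]]]] ?];
    rewrite /= !inE !(inj_eq inr_inj) !xpair_eqE
    (eq_sym j j') -?andb_orr -!val_eqE /= ?inordK //;
  by case: (j' == j); case: e => [[|[|[|[|[|//]]]]] ?].
Qed.

(** This is [c = N + 1]: each cycle has 12 elements and each path 11. *)
Definition apex : nat := (12 * m + 11 * n).+1.

(* The low elements of block k sit at positions 0..2, the high ones at 3..5. *)
Definition block k r : nat :=
  if r < 3 then 2 * n + 1 + 3 * k + r
  else apex - (3 * n + 1 + 3 * k + (r - 3)).

(** Cycle vertices use blocks [0] to [m - 1] and path vertices start at block [2 * m]; the [m]
    blocks in between are left to the cycle edges. *)
Definition vertex_label (u : V) : nat :=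
  match u with
  | inl (j, v) => block j (vertex_slot v)
  | inr (j, v) => block (2 * m + j) (vertex_slot v)
  end.

Definition edge_label (i : I) : nat :=
  match i with
  | inl (j, e) => block (m + j) (edge_slot e)
  | inr (j, e) =>
    nth 0 [:: apex - j.+1; j.+1; apex - (2 * n + j.+1);
              n + j.+1; apex - (n + j.+1)] e
  end.

(* The gaps are the differences between [apex] and the weights. *)
Definition vertex_gap (u : V) : nat :=
  match u with
  | inl (_, v) => nth 0 [:: n; n.-1; n.+1; n; n.-1; n.+1] v
  | inr (j, v) => nth 0 [:: j.+1; 0; 2 * n; n; 0; n + j.+1] v
  end.

Definition edge_gap (i : I) : nat :=
  match i with
  | inl (_, e) => nth 0 [:: n.+1; n; n.-1; n.+1; n; n.-1] e
  | inr (_, e) => nth 0 [:: n.+1; n; n.-1; n.+1; n] e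
  end.

(** Keeps the blocks clear of the path edges, whose labels are at most [2 * n] or at least
    [apex - 3 * n]. *)
Lemma block_bounds k r : k < 2 * m + n -> r < 6 ->
  2 * n < block k r /\ block k r + 3 * n < apex.
Proof. by rewrite /block /apex; case: (ltnP r 3); lia. Qed.

(** The low positions end at [6 * m + 5 * n] and the high ones begin right after it. *)
Lemma block_inj k k' r r' : k < 2 * m + n -> k' < 2 * m + n ->
  r < 6 -> r' < 6 -> block k r = block k' r' -> k = k' /\ r = r'.
Proof. by rewrite /block /apex; case: (ltnP r 3); case: (ltnP r' 3); lia. Qed.

Lemma vertex_label_inj : injective vertex_label.
Proof.
move=> [[j v]|[j v]] [[j' v']|[j' v']] /block_inj [];
  rewrite ?vertex_slot_lt //; have := ltn_ord j; have := ltn_ord j'; try lia.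
- by move=> _ _ /val_inj-> /vertex_slot_inj->.
- move=> _ _ jj' /vertex_slot_inj->; congr (inr (_, _)).
  by apply: val_inj => /=; lia.
Qed.

Lemma edge_label_inj : injective edge_label.
Proof.
have lt_block (j : 'I_m) : m + j < 2 * m + n by have := ltn_ord j; lia.
have neq (j : 'I_m) v (j' : 'I_n) e :
    edge_label (inl (j, v)) <> edge_label (inr (j', e)).
  have [] := block_bounds (lt_block j) (edge_slot_lt v).
  rewrite /= /apex; have := ltn_ord j'.
  by case: e => [[|[|[|[|[|//]]]]] ?] /=; lia.
move=> [[j v]|[j v]] [[j' v']|[j' v']].
- move/block_inj => /(_ (lt_block j) (lt_block j')).
  case/(_ (edge_slot_lt v) (edge_slot_lt v')) => [jj' /edge_slot_inj->].
  by congr (inl (_, _)); apply: val_inj => /=; lia.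
- by move/neq.
- by move/esym/neq.
have := ltn_ord j; have := ltn_ord j'; rewrite /= /apex.
case: v => [[|[|[|[|[|//]]]]] vP];
  case: v' => [[|[|[|[|[|//]]]]] vP'] /= lt lt' jj';
  try (exfalso; lia); by congr (inr (_, _)); apply: val_inj => /=; lia.
Qed.

Lemma vertex_edge_label u i : vertex_label u <> edge_label i.
Proof.
(* The last disjunction excludes the blocks [m + j] of the cycle edges. *)
have vertex_block : exists k r, [/\ vertex_label u = block k r,
    k < 2 * m + n, r < 6 & k < m \/ 2 * m <= k].
  case: u => [[j v]|[j v]]; have := ltn_ord j; do 2!eexists; split;
    [by [] | lia | exact: vertex_slot_lt | lia
    |by [] | lia | exact: vertex_slot_lt | lia].
have [k [r [-> kK r6 kE]]] := vertex_block.
case: i => [[j e]|[j e]]; have jP := ltn_ord j.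
  move/block_inj => /(_ kK _ r6 (edge_slot_lt e)) []; first lia.
  by lia.
have [] := block_bounds kK r6; rewrite /= /apex.
by case: e => [[|[|[|[|[|//]]]]] ?] /=; lia.
Qed.

Lemma vertex_label_bounds u : 0 < vertex_label u <= 12 * m + 11 * n.
Proof.
rewrite -ltnS -/apex.
case: u => [[j v]|[j v]]; have := ltn_ord j;
  rewrite /= /vertex_slot /edge_slot /block /apex;
  by case: v => [[|[|[|[|[|[|//]]]]]] ?] /=; lia.
Qed.

Lemma edge_label_bounds i : 0 < edge_label i <= 12 * m + 11 * n.
Proof.
case: i => [[j e]|[j e]]; have := ltn_ord j;
  rewrite /= /vertex_slot /edge_slot /block /apex.
  by case: e => [[|[|[|[|[|[|//]]]]]] ?] /=; lia.
by case: e => [[|[|[|[|[|//]]]]] ?] /=; lia.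
Qed.

(** On a path, [j] cancels from the sum of two consecutive edge labels; it survives only at the
    leaves, whose gaps run through [1] to [2 * n]. *)
Lemma vertex_weight u :
  \sum_(i <- incident u) edge_label i = apex - vertex_gap u.
Proof.
case: u => [[j v]|[j v]]; have := ltn_ord j.
  rewrite /= big_cons big_seq1 /= /vertex_slot /edge_slot /block /apex.
  by case: v => [[|[|[|[|[|[|//]]]]]] ?] /=; lia.
rewrite /= /apex.
by case: v => [[|[|[|[|[|[|//]]]]]] ?] /=;
  rewrite !big_cons big_nil /= !inordK //= /apex; lia.
Qed.

(** Each edge joins a low and a high position of one block, so the block index cancels and only the
    difference of the offsets moves the sum away from [apex - n]. *)
Lemma edge_weight i :
  vertex_label (source i) + vertex_label (target i) = apex - edge_gap i.
Proof.
case: i => [[j e]|[j e]]; have := ltn_ord j;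
  rewrite /= /vertex_slot /edge_slot /block /apex.
  by case: e => [[|[|[|[|[|[|//]]]]]] ?] /=; lia.
by case: e => [[|[|[|[|[|//]]]]] ?] /=; lia.
Qed.

(** * The two bounds for the union of cycles and paths *)

Lemma cycles_paths_indexing : @edge_indexing G I source target incident.
Proof.
split.
- case=> [[j e]|[j e]] /=; rewrite /sum_adj /copies_adj /= eqxx /=.
    by case: e => [[|[|[|[|[|[|//]]]]]] ?].
  by rewrite /path_adj /= eqxx.
(* The index is the endpoint whose successor is the other endpoint. *)
- case=> [[j v]|[j v]] [[j' v']|[j' v']] //= /andP[/= /eqP <-].
    case/andP=> _ /orP[]/eqP vE.
      by exists (inl (j, v)) => /=; congr [set _; inl (_, _)]; apply: val_inj.
    exists (inl (j, v')) => /=; rewrite setUC.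
    by congr [set _; inl (_, _)]; apply: val_inj.
  case/orP=> /eqP vE.
    have v5 : v < 5 by rewrite -ltnS vE.
    exists (inr (j, Ordinal v5)) => /=.
    by congr [set inr (_, _); inr (_, _)]; apply: val_inj.
  have v5 : v' < 5 by rewrite -ltnS vE.
  exists (inr (j, Ordinal v5)) => /=; rewrite setUC.
  by congr [set inr (_, _); inr (_, _)]; apply: val_inj.
(* Both endpoints of [i] are endpoints of [i'], so the two lie in one component; there a finite
   check remains. *)
- move=> i i' /= ends.
  have: source i \in [set source i'; target i'] by rewrite -ends !inE eqxx.
  have: target i \in [set source i'; target i'] by rewrite -ends !inE eqxx orbT.
  rewrite !inE {ends}.
  case: i i' => [[j e]|[j e]] [[j' e']|[j' e']] //=;
    rewrite ?(inj_eq inl_inj) ?(inj_eq inr_inj) !xpair_eqE;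
    case: (j =P j') => [<-|//] /= t_e s_e;
    suff -> : e = e' by []; apply: val_inj.
    by move: e e' t_e s_e; do 2![case=> [[|[|[|[|[|[|//]]]]]] ?]].
  by move: e e' t_e s_e; do 2![case=> [[|[|[|[|[|//]]]]] ?]].
- move=> [[j v]|[j v]] /=.
    by rewrite inE (inj_eq inl_inj) xpair_eqE eqxx /=;
       case: v => [[|[|[|[|[|[|//]]]]]] ?].
  case: v => [[|[|[|[|[|[|//]]]]]] ?] //=;
  by rewrite inE (inj_eq inr_inj) xpair_eqE eqxx -val_eqE /= !inordK.
- exact: mem_incident.
Qed.

Lemma cycles_paths_card : #|G| + #|I| = 12 * m + 11 * n.
Proof. by rewrite !card_sum !card_prod !card_ord; lia. Qed.

Lemma cycles_paths_labeling :
  exists2 f, @local_total_antimagic G f & num_weights f <= 2 * n + 1.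
Proof.
have vgap u : vertex_gap u <= 2 * n.
  by case: u => [[j v]|[j v]]; have := ltn_ord j;
     case: v => [[|[|[|[|[|[|//]]]]]] ?] /=; lia.
have egap i : edge_gap i <= 2 * n.
  case: i => [[j e]|[j e]]; have := ltn_ord j.
    by case: e => [[|[|[|[|[|[|//]]]]]] ?] /=; lia.
  by case: e => [[|[|[|[|[|//]]]]] ?] /=; lia.
(* Gaps are at most [2 * n], hence below [apex], so truncated subtraction keeps distinct gaps
   distinct. *)
have gap_neq a b : a <= 2 * n -> b <= 2 * n -> a <> b -> apex - a != apex - b.
  by rewrite /apex; lia.
have gap_in a : a <= 2 * n -> apex - a \in iota (apex - 2 * n) (2 * n + 1).
  by rewrite mem_iota /apex; lia.
rewrite -[2 * n + 1](size_iota (apex - 2 * n)).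
apply: (indexed_labeling cycles_paths_indexing vertex_label_inj edge_label_inj
  vertex_edge_label cycles_paths_card vertex_label_bounds edge_label_bounds
  vertex_weight edge_weight) => [i|i|u|u|i]; rewrite ?gap_in //.
- apply: gap_neq => //; case: i => [[j e]|[j e]]; have := ltn_ord j.
    by case: e => [[|[|[|[|[|[|//]]]]]] ?] /=; lia.
  by case: e => [[|[|[|[|[|//]]]]] ?] /=; lia.
- apply/andP; split; apply: gap_neq => //.
    case: i => [[j e]|[j e]]; have := ltn_ord j.
      by case: e => [[|[|[|[|[|[|//]]]]]] ?] /=; lia.
    by case: e => [[|[|[|[|[|//]]]]] ?] /=; lia.
  case: i => [[j e]|[j e]]; have := ltn_ord j.
    by case: e => [[|[|[|[|[|[|//]]]]]] ?] /=; lia.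
  by case: e => [[|[|[|[|[|//]]]]] ?] /=; lia.
- case: u => [[j v]|[j v]]; have := ltn_ord j.
    by case: v => [[|[|[|[|[|[|//]]]]]] ?]; rewrite /= inE andbT => _;
       apply: gap_neq; lia.
  by case: v => [[|[|[|[|[|[|//]]]]]] ?] //=;
     rewrite !inordK //= inE andbT => _; apply: gap_neq; lia.
Qed.

Lemma cycles_paths_lower_bound (f : element G -> nat) :
  total_labeling f -> 2 * n + 1 <= num_weights f.
Proof.
pose leaf (l : 'I_n + 'I_n) : V :=
  match l with inl j => inr (j, ord0) | inr j => inr (j, ord_max) end.
pose pend (l : 'I_n + 'I_n) : I :=
  match l with inl j => inr (j, inord 0) | inr j => inr (j, inord 4) end.
have -> : 2 * n + 1 = #|{: 'I_n + 'I_n}|.+1.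
  by rewrite card_sum card_ord; lia.
apply: (@leaf_lower_bound G I source target incident _ leaf pend f
  cycles_paths_indexing).
- move=> [j|j] [j'|j'] [] // -> //= /(congr1 val); rewrite /= !inordK //.
- by case.
- by case=> [[j v]|[j v]] //; case: v => [[|[|[|[|[|[|//]]]]]] ?].
- case=> [[j e]|[j e]] //; case: e => [[|[|[|[|[|//]]]]] ?] //.
- by have := cycles_paths_card; rewrite !card_sum !card_prod !card_ord; lia.
Qed.

End CyclesAndPaths.

Theorem theorem4p3 (m n : nat) (hm : 1 <= m) (hn : 1 <= n) :
  chi_lt_eq
    (disjoint_union (copies m (cycle_graph 6)) (copies n (path_graph 6)))
    (2 * n + 1).
Proof.
have [f f_lta f_le] := cycles_paths_labeling m hn.
split=> [|g [g_total _ _ _]]; last exact: cycles_paths_lower_bound.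
exists f => //; apply/eqP; rewrite eqn_leq f_le.
by case: f_lta => f_total _ _ _; apply: cycles_paths_lower_bound.
Qed.
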